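(* The group $\mathbb{Z}\wr\mathbb{Z}$ is a $3$-state and $3$-letter automata group; that is, there is an invertible automaton with $3$ states over an alphabet of $3$ letters such that the group of automorphisms of the rooted $3$-tree generated by its states is isomorphic to $\mathbb{Z}\wr\mathbb{Z}$.
   Context: $\mathbb{Z}\wr\mathbb{Z}$ is the restricted wreath product $\big(\bigoplus_{\mathbb{Z}}\mathbb{Z}\big)\rtimes\mathbb{Z}$. Let $Y$ be an alphabet of size $3$ and let $\mathcal{A}_3$ be the automorphism group of the rooted $3$-tree of finite strings over $Y$. Each $\alpha\in\mathcal{A}_3$ has states $\alpha_y\in\mathcal{A}_3$ ($y\in Y$) given by $(yu)^\alpha=y^{\alpha}u^{\alpha_y}$. Concretely, a $3$-state, $3$-letter invertible automaton amounts to a set $S\subset\mathcal{A}_3$ of three automorphisms such that $\alpha_y\in S$ for all $\alpha\in S$, $y\in Y$ (the identity automorphism $e$, if it lies in $S$, counts as one of the states); the group it generates is the subgroup $\langle S\rangle\le\mathcal{A}_3$. *)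

(* Defs.v *)
From HB Require Import structures.
From mathcomp Require Import all_boot all_order all_algebra finmap.
From mathcomp Require Import boolp classical_sets functions cardinality.

Set Implicit Arguments.
Unset Strict Implicit.
Unset Printing Implicit Defensive.

Import GRing.Theory.

Local Open Scope classical_set_scope.

(* The rooted #|Y|-tree: the vertices are the strings over Y, the root is the
   empty string, and the children of u are the strings uy. *)
Definition tree_adj (Y : finType) (u v : seq Y) : Prop :=
  exists y, v = rcons u y \/ u = rcons v y.

Definition is_tree_aut (Y : finType) (f : seq Y -> seq Y) : Prop :=
  [/\ bijective f, f [::] = [::]
    & forall u v, tree_adj (f u) (f v) <-> tree_adj u v].

Record tree_aut (Y : finType) := TreeAut {
  tree_fun :> seq Y -> seq Y;
  tree_funP : is_tree_aut tree_fun }.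

HB.instance Definition _ (Y : finType) := gen_eqMixin (tree_aut Y).
HB.instance Definition _ (Y : finType) := gen_choiceMixin (tree_aut Y).

Section TreeAutGroup.
Variable Y : finType.
Implicit Types a b c : tree_aut Y.

Lemma tree_aut_eq a b : a =1 b -> a = b.
Proof.
case: a b => [f fP] [g gP] /= /funext fg; subst g.
by congr TreeAut; exact: Prop_irrelevance.
Qed.

Lemma tree_aut_id_subproof : is_tree_aut (@id (seq Y)).
Proof. by split=> //; exists id. Qed.

Definition tree_aut_one := TreeAut tree_aut_id_subproof.

Lemma tree_aut_mul_subproof a b : is_tree_aut (b \o a).
Proof.
have [bf f0 fE] := tree_funP a; have [bg g0 gE] := tree_funP b; split.
- exact: bij_comp.
- by rewrite /= f0.
- by move=> u v /=; rewrite gE fE.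
Qed.

(* Automorphisms act on the right: u^(ab) = (u^a)^b. *)
Definition tree_aut_mul a b := TreeAut (tree_aut_mul_subproof a b).

Lemma tree_aut_inv_ex a : exists g, cancel a g /\ cancel g a.
Proof. by have [[g fK gK] _ _] := tree_funP a; exists g. Qed.

Definition tree_aut_inv_fun a := sval (cid (tree_aut_inv_ex a)).

Lemma tree_aut_inv_funK a : cancel a (tree_aut_inv_fun a).
Proof. by rewrite /tree_aut_inv_fun; case: cid => g []. Qed.

Lemma tree_aut_funK a : cancel (tree_aut_inv_fun a) a.
Proof. by rewrite /tree_aut_inv_fun; case: cid => g []. Qed.

Lemma tree_aut_inv_subproof a : is_tree_aut (tree_aut_inv_fun a).
Proof.
have K := tree_aut_inv_funK a; have K' := tree_aut_funK a.
have [_ a0 aE] := tree_funP a; split; first by exists a.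
  by apply: (can_inj K); rewrite K' a0.
by move=> u v; rewrite -aE !K'.
Qed.

Definition tree_aut_inv a := TreeAut (tree_aut_inv_subproof a).

Lemma tree_aut_mulA : associative tree_aut_mul.
Proof. by move=> a b c; apply: tree_aut_eq. Qed.
Lemma tree_aut_mul1 : left_id tree_aut_one tree_aut_mul.
Proof. by move=> a; apply: tree_aut_eq. Qed.
Lemma tree_aut_mulr1 : right_id tree_aut_one tree_aut_mul.
Proof. by move=> a; apply: tree_aut_eq. Qed.
Lemma tree_aut_mulV : left_inverse tree_aut_one tree_aut_inv tree_aut_mul.
Proof. by move=> a; apply: tree_aut_eq; exact: tree_aut_funK. Qed.
Lemma tree_aut_mulrV : right_inverse tree_aut_one tree_aut_inv tree_aut_mul.
Proof. by move=> a; apply: tree_aut_eq; exact: tree_aut_inv_funK. Qed.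

HB.instance Definition _ := isGroup.Build (tree_aut Y)
  tree_aut_mulA tree_aut_mul1 tree_aut_mulr1 tree_aut_mulV tree_aut_mulrV.

Lemma tree_aut_nil a : a [::] = [::].
Proof. by case: (tree_funP a). Qed.

Lemma tree_aut_rcons a u y : exists z, a (rcons u y) = rcons (a u) z.
Proof.
have [bij_a a0 aE] := tree_funP a.
have : tree_adj (a u) (a (rcons u y)) by rewrite aE; exists y; left.
elim/last_ind: u y => [|u x IHu] y [z [->|]]; try by exists z.
  by rewrite a0; case: (a _).
have [t ->] : exists t, a (rcons u x) = rcons (a u) t.
  by apply: IHu; rewrite aE; exists x; left.
move=> /rcons_inj[/(bij_inj bij_a)/(congr1 size)]; rewrite !size_rcons => /eqP.
by rewrite -addn2 -{1}[size u]addn0 eqn_add2l.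
Qed.

Lemma tree_aut_letter a y : exists z, a [:: y] = [:: z].
Proof.
by have [z /=] := tree_aut_rcons a [::] y; rewrite tree_aut_nil; exists z.
Qed.

Lemma tree_aut_cat a u v : exists w, a (u ++ v) = a u ++ w.
Proof.
elim/last_ind: v => [|v y [w IHv]]; first by exists [::]; rewrite !cats0.
by have [z] := tree_aut_rcons a (u ++ v) y;
  rewrite rcons_cat IHv rcons_cat => ->; exists (rcons w z).
Qed.

Lemma tree_aut_cons a y u : a (y :: u) = a [:: y] ++ behead (a (y :: u)).
Proof.
have [w] := tree_aut_cat a [:: y] u; rewrite cat1s => ->.
by have [z ->] := tree_aut_letter a y.
Qed.

Lemma tree_adj_cons (y : Y) u v : tree_adj (y :: u) (y :: v) <-> tree_adj u v.
Proof.
split=> -[z zP]; exists z; move: zP; rewrite -?rcons_cons;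
  by case=> [[->]|[->]]; [left|right].
Qed.

Lemma tree_state_subproof a y : is_tree_aut (fun u => behead (a (y :: u))).
Proof.
have [z az] := tree_aut_letter a y.
have aS u : a (y :: u) = z :: behead (a (y :: u)) by rewrite tree_aut_cons az.
have bz : tree_aut_inv a [:: z] = [:: y] by rewrite -az /= tree_aut_inv_funK.
have bS u : tree_aut_inv a (z :: u) = y :: behead (tree_aut_inv a (z :: u)).
  by rewrite tree_aut_cons bz.
split.
- exists (fun u => behead (tree_aut_inv a (z :: u))) => u /=.
    by rewrite -aS tree_aut_inv_funK.
  by rewrite -bS tree_aut_funK.
- by rewrite az.
- move=> u v; rewrite -(tree_adj_cons z) -!aS.
  by have [_ _ ->] := tree_funP a; exact: tree_adj_cons.
Qed.

(* The state a_y, characterized by (yu)^a = y^a u^(a_y): see tree_stateE. *)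
Definition tree_state a y : tree_aut Y := TreeAut (tree_state_subproof a y).

Lemma tree_stateE a y u : a (y :: u) = a [:: y] ++ tree_state a y u.
Proof. exact: tree_aut_cons. Qed.

End TreeAutGroup.

Definition generated (G : groupType) (S : set G) : set G :=
  smallest (fun A : set G => group_closed (mem A)) S.

(* A, meant to be a subgroup of H, is isomorphic to G. *)
Definition isomorphic_to_subgroup (G H : groupType) (A : set H) : Prop :=
  exists phi : {multiplicative G -> H}, set_bij [set: G] A phi.

Local Open Scope fset_scope.
Local Open Scope ring_scope.

Definition lamp := {fsfun int -> int with 0}.

Definition lamp_add (f g : lamp) : lamp :=
  [fsfun x in finsupp f `|` finsupp g => f x + g x].

Definition lamp_opp (f : lamp) : lamp := [fsfun x in finsupp f => - f x].

Definition lamp_shift (m : int) (f : lamp) : lamp :=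
  [fsfun x in [fset y + m | y in finsupp f] => f (x - m)].

Lemma lamp_addE f g x : lamp_add f g x = f x + g x.
Proof.
rewrite /lamp_add fsfunE in_fsetU.
by case: (finsuppP f x) => _; case: (finsuppP g x) => _; rewrite //= addr0.
Qed.

Lemma lamp_oppE f x : lamp_opp f x = - f x.
Proof. by rewrite /lamp_opp fsfunE; case: finsuppP; rewrite ?oppr0. Qed.

Lemma lamp_shiftE m f x : lamp_shift m f x = f (x - m).
Proof.
rewrite /lamp_shift fsfunE; case: ifPn => // /negP xm.
rewrite fsfun_dflt//; apply/negP => fx; apply: xm.
by apply/imfsetP; exists (x - m) => //=; rewrite subrK.
Qed.

(* The restricted wreath product of Z by Z: the semidirect product of the
   finitely supported functions on Z by Z acting by translation. *)
Definition ZwrZ : Type := (lamp * int)%type.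
HB.instance Definition _ := Choice.copy ZwrZ (lamp * int)%type.

Definition ZwrZ_mul (a b : ZwrZ) : ZwrZ :=
  (lamp_add a.1 (lamp_shift a.2 b.1), a.2 + b.2).
Definition ZwrZ_one : ZwrZ := ([fsfun], 0).
Definition ZwrZ_inv (a : ZwrZ) : ZwrZ :=
  (lamp_shift (- a.2) (lamp_opp a.1), - a.2).

Definition lampE := (lamp_addE, lamp_oppE, lamp_shiftE).

Lemma ZwrZ_mulA : associative ZwrZ_mul.
Proof.
move=> a b c; congr pair; rewrite /= ?addrA //.
by apply/fsfunP => x; rewrite !lampE addrA opprD addrA.
Qed.
Lemma ZwrZ_mul1 : left_id ZwrZ_one ZwrZ_mul.
Proof.
move=> [f m]; congr pair; rewrite /= ?add0r //.
by apply/fsfunP => x; rewrite !lampE fsfunE add0r subr0.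
Qed.
Lemma ZwrZ_mulr1 : right_id ZwrZ_one ZwrZ_mul.
Proof.
move=> [f m]; congr pair; rewrite /= ?addr0 //.
by apply/fsfunP => x; rewrite !lampE fsfunE addr0.
Qed.
Lemma ZwrZ_mulV : left_inverse ZwrZ_one ZwrZ_inv ZwrZ_mul.
Proof.
move=> [f m]; congr pair; rewrite /= ?addNr //.
by apply/fsfunP => x; rewrite !lampE fsfunE addNr.
Qed.
Lemma ZwrZ_mulrV : right_inverse ZwrZ_one ZwrZ_inv ZwrZ_mul.
Proof.
move=> [f m]; congr pair; rewrite /= ?subrr //.
by apply/fsfunP => x; rewrite !lampE fsfunE opprK subrK subrr.
Qed.

HB.instance Definition _ := isGroup.Build ZwrZ
  ZwrZ_mulA ZwrZ_mul1 ZwrZ_mulr1 ZwrZ_mulV ZwrZ_mulrV.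

(* Main.v *)
Require Import Defs.
From HB Require Import structures.
From mathcomp Require Import all_boot all_order all_algebra finmap.
From mathcomp Require Import boolp classical_sets functions cardinality.
From mathcomp Require Import zify.

Set Implicit Arguments.
Unset Strict Implicit.
Unset Printing Implicit Defensive.

Import GRing.Theory.

(** The automaton has the identity e and two further states a, t. Two of the
    letters are the bits 0 and 1, the third is written *, and states are listed
    in the order 0, 1, *:
      t = (e, t, e), exchanging 0 and 1;   a = (a, e, t), fixing every letter.
    On the bits alone, t is the odometer (adding 1 with carry), so t^2 acts
    below each bit as t; a conjugate a^(t^i) acts below one bit, chosen by the
    parity of i, as such a conjugate, and trivially below the other bit. Two
    conjugates therefore commute on the bits by induction on the level, and
    below * they both act as t. So the conjugates a^(t^i) generate an
    abelian group, and <a, t> is a quotient of Z wr Z. The bits alone would make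
    a trivial; the letter * makes its order infinite, and the bits then tell its
    conjugates apart.

    The proof runs in the opposite direction. Feeding the expected states back
    into the wreath product gives a closed formula for the states of an
    arbitrary element (f, m): below the bit b, f is decimated along one parity
    class ([lamp_half]) and m becomes the carry of b + m; below * one finds the
    translation by the sum of the values of f. These formulas obey the cocycle
    rule [wr_stateM], hence define an action of Z wr Z on strings ([wr_actM]),
    by tree automorphisms.

    The action is faithful ([wr_aut_inj]). In an element of the kernel, m has to
    be even, and the state below 0 is in the kernel with m/2 in place of m, so
    m = 0. The state below * then shows that the values of f sum to 0, and so do
    those of every decimation of f. As repeated halving isolates each value of
    f, all of them vanish. Finally the generated subgroup is the whole image,
    since a and t generate Z wr Z ([wr_gens_ind]). *)

(** * Sums and decimations of finitely supported functions *)

Local Open Scope fset_scope.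
Local Open Scope ring_scope.

Definition single (i c : int) : lamp := [fsfun x in [fset i] => c].

Lemma singleE i c x : single i c x = if x == i then c else 0.
Proof. by rewrite /single fsfunE inE. Qed.

Definition lamp_total (f : lamp) : int := \sum_(i <- finsupp f) f i.

Lemma lamp_totalE (B : {fset int}) f :
  finsupp f `<=` B -> lamp_total f = \sum_(i <- B) f i.
Proof. by move=> sB; apply: big_fset_incl => // x _; exact: fsfun_dflt. Qed.

Lemma finsupp_lamp_add f g : finsupp (lamp_add f g) `<=` finsupp f `|` finsupp g.
Proof.
apply/fsubsetP => x; rewrite mem_finsupp lampE in_fsetU !mem_finsupp.
by case: (f x =P 0) => [->|//] /=; rewrite add0r.
Qed.

Lemma lamp_totalD f g :
  lamp_total (lamp_add f g) = lamp_total f + lamp_total g.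
Proof.
rewrite (lamp_totalE (finsupp_lamp_add f g)).
rewrite (lamp_totalE (fsubsetUl (finsupp f) (finsupp g))).
rewrite (lamp_totalE (fsubsetUr (finsupp f) (finsupp g))) -big_split /=.
by apply: eq_bigr => i _; rewrite lampE.
Qed.

Lemma lamp_total_shift m f : lamp_total (lamp_shift m f) = lamp_total f.
Proof.
rewrite (@lamp_totalE [fset i + m | i in finsupp f]).
  rewrite big_imfset /=; last by move=> i j _ _; apply: addIr.
  by apply: eq_bigr => i _; rewrite lampE addrK.
apply/fsubsetP => x; rewrite mem_finsupp lampE => fx.
by apply/imfsetP; exists (x - m); rewrite ?subrK //= mem_finsupp.
Qed.

Lemma lamp_total_single i c : lamp_total (single i c) = c.
Proof.
rewrite (@lamp_totalE [fset i]); first by rewrite big_seq_fset1 singleE eqxx.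
apply/fsubsetP => x; rewrite mem_finsupp singleE inE.
by case: (x == i); rewrite ?eqxx.
Qed.

Lemma lamp_total0 : lamp_total [fsfun] = 0.
Proof. by rewrite /lamp_total finsupp0 big_seq_fset0. Qed.

(** Multiplication by 2 and the two translations split the integers into the
    even and the odd ones; [2 * j - b], rather than [2 * j + b], is what the
    right action requires: the unit lamp at i is t^i a t^-i, and t^i sends the
    letter b to 0, the letter below which a acts as a, exactly when b + i is
    even; the carry, hence the place of the new lamp, is then (b + i) / 2. *)
Definition lamp_half (b : bool) (f : lamp) : lamp :=
  [fsfun j in [fset ((i + b%:Z) %/ 2)%Z | i in finsupp f] => f (2 * j - b%:Z)].

Lemma lamp_halfE b f j : lamp_half b f j = f (2 * j - b%:Z).
Proof.
rewrite /lamp_half fsfunE; case: ifPn => // /negP jN.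
rewrite fsfun_dflt //; apply/negP => fj; apply: jN.
by apply/imfsetP; exists (2 * j - b%:Z) => //=; rewrite subrK mulKz.
Qed.

(** * States of an element of the wreath product *)

Definition shift_bit (m : int) (b : bool) : bool := ((b%:Z + m) %% 2)%Z == 1.

Definition carry (m : int) (b : bool) : int := ((b%:Z + m) %/ 2)%Z.

Lemma shift_bit_carry m (b : bool) :
  b%:Z + m = 2 * carry m b + (shift_bit m b)%:Z.
Proof. by rewrite /shift_bit /carry; lia. Qed.

Lemma shift_bitD m n b : shift_bit (m + n) b = shift_bit n (shift_bit m b).
Proof. by rewrite /shift_bit; lia. Qed.

Lemma carryD m n b : carry (m + n) b = carry m b + carry n (shift_bit m b).
Proof. by rewrite /shift_bit /carry; lia. Qed.

Lemma shift_bit0 b : shift_bit 0 b = b.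
Proof. by case: b. Qed.

Lemma carry0 b : carry 0 b = 0.
Proof. by case: b. Qed.

(** Letters are encoded by [option bool]: the two bits, and [None] for the third
    letter, which every element fixes. *)
Definition wr_letter (g : ZwrZ) (x : option bool) : option bool :=
  omap (shift_bit g.2) x.

Definition wr_state (g : ZwrZ) (x : option bool) : ZwrZ :=
  if x is Some b then (lamp_half b g.1, carry g.2 b)
  else ([fsfun], lamp_total g.1).

Lemma wr_letterM (g h : ZwrZ) x :
  wr_letter (g * h)%g x = wr_letter h (wr_letter g x).
Proof. by case: x => //= b; rewrite shift_bitD. Qed.

(** The rule for the states of a product of automorphisms, verified in the wreath
    product itself; it is what makes the recursive definition [wr_act] a group
    action. On the lamps it reduces to b + m = 2 * carry + bit. *)
Lemma wr_stateM (g h : ZwrZ) x :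
  wr_state (g * h)%g x = (wr_state g x * wr_state h (wr_letter g x))%g.
Proof.
case: x => [b|]; congr pair => /=.
- apply/fsfunP => j; rewrite !(lampE, lamp_halfE); congr (_ + h.1 _).
  by have := shift_bit_carry g.2 b; lia.
- exact: carryD.
- by apply/fsfunP => j; rewrite !lampE !fsfunE addr0.
- by rewrite lamp_totalD lamp_total_shift.
Qed.

Lemma wr_letter1 x : wr_letter 1%g x = x.
Proof. by case: x => //= b; rewrite shift_bit0. Qed.

Lemma wr_state1 x : wr_state 1%g x = 1%g.
Proof.
case: x => [b|]; congr pair => /=; rewrite ?carry0 ?lamp_total0 //.
by apply/fsfunP => j; rewrite lamp_halfE !fsfunE.
Qed.

(** * The three generators *)

Definition wr_lamp : ZwrZ := (single 0 1, 0).
Definition wr_shift : ZwrZ := ([fsfun], 1).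

(** The states e, a and t of the automaton, which will be the images of these
    elements under the action. *)
Definition wr_gens : seq ZwrZ := [:: 1%g; wr_lamp; wr_shift].

Lemma wr_gens_uniq : uniq wr_gens.
Proof.
rewrite /= !inE negb_or !andbT -andbA.
apply/and3P; split; apply/eqP; try by move=> /(congr1 snd).
by move=> /(congr1 fst)/fsfunP/(_ 0); rewrite singleE fsfunE.
Qed.

Lemma wr_gens1 : 1%g \in wr_gens.
Proof. exact: mem_head. Qed.

Lemma wr_gens_lamp : wr_lamp \in wr_gens.
Proof. by rewrite in_cons mem_head orbT. Qed.

Lemma wr_gens_shift : wr_shift \in wr_gens.
Proof. exact: (mem_last 1%g [:: wr_lamp; wr_shift]). Qed.

Lemma wr_state_lamp x :
  wr_state wr_lamp x =
  if x is Some b then if b then 1%g else wr_lamp else wr_shift.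
Proof.
case: x => [b|] /=; last by rewrite lamp_total_single.
rewrite carry0; case: b; congr pair; apply/fsfunP => j;
  rewrite lamp_halfE !singleE ?fsfunE; do ?case: eqP; lia.
Qed.

Lemma wr_state_shift x :
  wr_state wr_shift x = if x is Some true then wr_shift else 1%g.
Proof.
case: x => [b|] /=; last by rewrite lamp_total0.
by case: b; congr pair; apply/fsfunP => j; rewrite lamp_halfE !fsfunE.
Qed.

Lemma wr_gens_state g x : g \in wr_gens -> wr_state g x \in wr_gens.
Proof.
move=> gS; have: [|| g == 1%g, g == wr_lamp | g == wr_shift].
  by move: gS; rewrite !inE.
case/or3P=> /eqP-> {g gS}.
- rewrite wr_state1; exact: wr_gens1.
- rewrite wr_state_lamp; case: x => [[]|].
  + exact: wr_gens1.
  + exact: wr_gens_lamp.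
  + exact: wr_gens_shift.
- rewrite wr_state_shift; case: x => [[]|].
  + exact: wr_gens_shift.
  + exact: wr_gens1.
  + exact: wr_gens1.
Qed.

(** * The action on the tree *)

Section Action.
Variables (Y : finType) (c : Y -> option bool) (d : option bool -> Y).
Hypotheses (cK : cancel c d) (dK : cancel d c).

Fixpoint wr_act (g : ZwrZ) (u : seq Y) : seq Y :=
  if u is y :: v then d (wr_letter g (c y)) :: wr_act (wr_state g (c y)) v
  else [::].

Lemma wr_actM (g h : ZwrZ) u : wr_act (g * h)%g u = wr_act h (wr_act g u).
Proof.
elim: u g h => //= y u IHu g h.
by rewrite wr_letterM wr_stateM IHu dK.
Qed.

Lemma wr_act1 u : wr_act 1%g u = u.
Proof. by elim: u => //= y u IHu; rewrite wr_letter1 wr_state1 cK IHu. Qed.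

Lemma wr_act_rcons g u y : exists z, wr_act g (rcons u y) = rcons (wr_act g u) z.
Proof.
elim: u g => [|x u IHu] g /=; first by exists (d (wr_letter g (c y))).
by have [z ->] := IHu (wr_state g (c x)); exists z.
Qed.

Lemma wr_actK g : cancel (wr_act g) (wr_act g^-1%g).
Proof. by move=> u; rewrite -wr_actM mulgV wr_act1. Qed.

Lemma wr_act_adj g u v : tree_adj u v -> tree_adj (wr_act g u) (wr_act g v).
Proof.
case=> y [->|->].
  by have [z ->] := wr_act_rcons g u y; exists z; left.
by have [z ->] := wr_act_rcons g v y; exists z; right.
Qed.

Lemma wr_act_tree_aut g : is_tree_aut (wr_act g).
Proof.
split=> //.
  exists (wr_act g^-1%g); first exact: wr_actK.
  by move=> u; rewrite -wr_actM mulVg wr_act1.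
move=> u v; split; last exact: wr_act_adj.
by move=> /(wr_act_adj g^-1%g); rewrite !wr_actK.
Qed.

Definition wr_aut (g : ZwrZ) : tree_aut Y := TreeAut (wr_act_tree_aut g).

Lemma wr_autM : {morph wr_aut : g h / (g * h)%g}.
Proof. by move=> g h; apply: tree_aut_eq => u /=; rewrite wr_actM. Qed.

HB.instance Definition _ := isMultiplicative.Build ZwrZ (tree_aut Y) wr_aut wr_autM.

Lemma wr_aut1 : wr_aut 1%g = 1%g.
Proof. by apply: tree_aut_eq => u /=; rewrite wr_act1. Qed.

Lemma wr_autV g : wr_aut g^-1%g = (wr_aut g)^-1%g.
Proof. by apply: (mulIg (wr_aut g)); rewrite -wr_autM !mulVg wr_aut1. Qed.

Lemma tree_state_wr_aut g y : tree_state (wr_aut g) y = wr_aut (wr_state g (c y)).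
Proof. exact: tree_aut_eq. Qed.

Lemma wr_aut_letter g x : wr_aut g = 1%g -> wr_letter g x = x.
Proof.
move=> g1; apply: (can_inj dK).
by have /= [] := congr1 (fun a : tree_aut Y => a [:: d x]) g1; rewrite dK.
Qed.

Lemma wr_aut_state g x : wr_aut g = 1%g -> wr_aut (wr_state g x) = 1%g.
Proof.
move=> g1; rewrite -(dK x) -tree_state_wr_aut g1.
exact: tree_aut_eq.
Qed.

(** Fixing the letter 0 forces the translation part to be even, and the state
    below 0 halves it: it is divisible by every power of 2. *)
Lemma wr_aut_shift_eq0 g : wr_aut g = 1%g -> g.2 = 0.
Proof.
have [n] := ubnP `|g.2|%N; elim: n g => // n IHn g lt_g_n g1.
have even_g : shift_bit g.2 false = false.
  by have [] := wr_aut_letter (Some false) g1.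
have /IHn /= := wr_aut_state (Some false) g1.
by have := shift_bit_carry g.2 false; rewrite even_g; lia.
Qed.

(** Below the third letter only the translation by the total is left, so the
    previous lemma applies to it. *)
Lemma wr_aut_total_eq0 g : wr_aut g = 1%g -> lamp_total g.1 = 0.
Proof. by move=> /(wr_aut_state None)/wr_aut_shift_eq0. Qed.

(** Induction on n: when f is supported within distance 2^0 of i, its total is
    the single value f(i); otherwise pass below the bit for which i survives
    the decimation, which halves all distances to i. *)
Lemma wr_aut_near_eq0 n g i : wr_aut g = 1%g ->
  (forall j, g.1 j != 0 -> (`|j - i| < 2 ^ n)%N) -> g.1 i = 0.
Proof.
elim: n g i => [|n IHn] g i g1 near_i.
  have := wr_aut_total_eq0 g1; rewrite (@lamp_totalE [fset i]) ?big_seq_fset1 //.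
  by apply/fsubsetP => j; rewrite mem_finsupp inE => /near_i; lia.
(* The bit with i + b even: f(i) is then a value of the decimation at b. *)
pose b := ((i %% 2)%Z == 1).
have iE : i = 2 * ((i + b%:Z) %/ 2)%Z - b%:Z by rewrite /b; lia.
rewrite iE -lamp_halfE.
apply: (IHn (wr_state g (Some b))); first exact: wr_aut_state.
by move=> j /=; rewrite lamp_halfE => /near_i; rewrite expnS; lia.
Qed.

Lemma wr_aut_inj : injective wr_aut.
Proof.
suff triv g : wr_aut g = 1%g -> g = 1%g.
  move=> g h gh; apply: (mulIg h^-1%g); rewrite mulgV; apply: triv.
  by rewrite wr_autM gh -wr_autM mulgV wr_aut1.
move=> g1; rewrite [g]surjective_pairing (wr_aut_shift_eq0 g1); congr pair.
apply/fsfunP => i; rewrite fsfunE.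
(* The sum is a crude bound for all distances |j - i|, hence so is 2 to it. *)
apply: (@wr_aut_near_eq0 (\sum_(j <- finsupp g.1) `|j - i|)%N) => // j gj.
apply: leq_ltn_trans (ltn_expl _ (isT : 1 < 2)%N).
by rewrite (big_fsetD1 j) ?mem_finsupp //= leq_addr.
Qed.

End Action.

(** * Generation of the wreath product *)

Section Generation.
Variable B : ZwrZ -> Prop.
Hypotheses (B1 : B 1%g) (BV : forall g h, B g -> B h -> B (g / h)%g).

Let BM g h : B g -> B h -> B (g * h)%g.
Proof. by move=> Bg Bh; rewrite -[h]invgK -[h^-1%g]mul1g; do ?apply: BV. Qed.

(** Used for the powers of t and for the powers of the lamp at a fixed place. *)
Lemma cyclic_closed (F : int -> ZwrZ) :
  (forall m n, F (m + n) = (F m * F n)%g) -> B (F 1) -> forall m, B (F m).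
Proof.
move=> FD BF1; have F0 : F 0 = 1%g by apply: (mulgI (F 0%R)); rewrite -FD mulg1.
elim/int_ind => [|n IHn|n IHn]; first by rewrite F0.
  by rewrite -addn1 PoszD FD; apply: BM.
have <- : (F (- n%:Z)%R / F 1%R)%g = F (- n.+1%:Z); last exact: BV.
by apply: (mulIg (F 1%R)); rewrite -mulgA mulVg mulg1 -FD; congr F; lia.
Qed.

Lemma wr_gens_ind : B wr_lamp -> B wr_shift -> forall g, B g.
Proof.
move=> Ba Bt.
pose tr m : ZwrZ := ([fsfun], m); pose la f : ZwrZ := (f, 0).
have Btr m : B (tr m).
  apply: cyclic_closed => // i j; congr pair.
  by apply/fsfunP => x; rewrite !lampE !fsfunE.
have Bsingle i x : B (la (single i x)).
  apply: (cyclic_closed (F := fun x => la (single i x))) => [m n|].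
    congr pair; apply/fsfunP => j; rewrite !lampE !singleE subr0.
    by case: (j == i).
  (* The lamp at i is the conjugate of the lamp at 0 by t^(-i). *)
  have -> : la (single i 1) = (tr i * wr_lamp / tr i)%g.
    congr pair => /=; last by rewrite addr0 subrr.
    apply/fsfunP => j; rewrite !lampE !singleE !fsfunE.
    by rewrite add0r subr_eq0 oppr0 addr0.
  by apply: BV => //; apply: BM.
suff Blamp f : B (la f).
  case=> f m; have -> : (f, m) = (la f * tr m)%g.
    congr pair; last by rewrite /= add0r.
    by apply/fsfunP => x; rewrite !lampE fsfunE addr0.
  exact: BM.
have [n] := ubnP #|` finsupp f|; elim: n f => // n IHn f lt_f_n.
have [f0|[i fi]] := fset_0Vmem (finsupp f).
  suff -> : f = [fsfun] by [].
  by apply/fsfunP => x; rewrite fsfunE fsfun_dflt // f0.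
pose g : lamp := lamp_add f (single i (- f i)).
have gE j : g j = if j == i then 0 else f j.
  by rewrite lampE singleE; case: eqP => [->|_]; rewrite ?subrr ?addr0.
have -> : la f = (la g * la (single i (f i)))%g.
  congr pair; apply/fsfunP => j; rewrite lamp_addE lamp_shiftE gE singleE subr0.
  by case: eqP => [->|_]; rewrite ?add0r ?addr0.
apply: BM => //; apply: IHn; apply: (@leq_trans #|` finsupp f|); last by rewrite -ltnS.
rewrite (cardfsD1 i (finsupp f)) fi add1n ltnS; apply: fsubset_leq_card.
apply/fsubsetP => j; rewrite in_fsetD1 !mem_finsupp gE.
by case: (j == i).
Qed.

End Generation.

(** * The automaton *)

Lemma card_seq_uniq (T : eqType) (s : seq T) :
  uniq s -> ([set` s] #= `I_(size s))%card.
Proof.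
case: s => [|x0 s0]; first by rewrite set_nil II0.
move: (x0 :: s0) => s us.
apply/card_set_bijP; exists (index^~ s); split.
- by move=> x /=; rewrite index_mem.
- by move=> x y /set_mem xs /set_mem ys /(congr1 (nth x s)); rewrite !nth_index.
- by move=> n /= ns; exists (nth x0 s n); [exact: mem_nth|exact: index_uniq].
Qed.

Local Close Scope ring_scope.
Local Close Scope fset_scope.

Theorem proposition3p1 (Y : finType) (hY : #|Y| = 3) :
  exists S : set (tree_aut Y),
    [/\ (S #= `I_3)%card,
        forall a : tree_aut Y, S a -> forall y : Y, S (tree_state a y)
      & isomorphic_to_subgroup ZwrZ (generated S)].
Proof.
have [c [d cK dK]] : exists c : Y -> option bool, bijective c.
  have cardE : #|Y| = #|{: option bool}| by rewrite hY card_option card_bool.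
  exists (fun y => enum_val (cast_ord cardE (enum_rank y))).
  exists (fun x => enum_val (cast_ord (esym cardE) (enum_rank x))) => x;
  by rewrite enum_valK ?cast_ordK ?cast_ordKV enum_rankK.
pose phi := wr_aut cK dK.
have phi_div g h : phi (g / h)%g = (phi g / phi h)%g.
  by rewrite /phi wr_autM wr_autV.
exists (phi @` [set` wr_gens])%classic; split.
- rewrite (card_eql (inj_card_eq _)); last by move=> g h _ _; exact: wr_aut_inj.
  exact: (card_seq_uniq wr_gens_uniq).
- move=> _ [g gS <-] y; exists (wr_state g (c y)); first exact: wr_gens_state.
  by rewrite tree_state_wr_aut.
exists phi; split.
- move=> g _ A [[A1 AV] SA].
  have inA h : h \in wr_gens -> A (phi h) by move=> hS; apply: SA; exists h.
  apply: (wr_gens_ind (B := fun g => A (phi g))).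
  + exact: inA wr_gens1.
  + move=> h k Ah Ak; rewrite phi_div.
    by apply/set_mem/AV; apply/mem_set.
  + exact: inA wr_gens_lamp.
  + exact: inA wr_gens_shift.
- by move=> g h _ _; exact: wr_aut_inj.
apply: smallest_sub; last by move=> _ [g _ <-]; exists g.
split; first by apply/mem_set; exists 1%g => //; exact: wr_aut1.
move=> a b /set_mem[g _ <-] /set_mem[h _ <-]; apply/mem_set.
by exists (g / h)%g => //; exact: phi_div.
Qed.
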